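(* Assume the finite-sum setting, that $f$ is $L$-smooth, and that $\tilde\nabla_K$ satisfies the strong growth condition with constant $\rho_K\ge1$. Let $(x_n)$ be generated by SNAG with batch size $K$ and let $\varepsilon>0$. (i) If $f$ is convex with minimizer $x^\ast$, and $s=\frac{1}{L\rho_K}$, $\eta_n=\frac{1}{L\rho_K^2}\frac{n+1}{2}$, $\beta=1$, $\alpha_n=\frac{n^2/(n+1)}{2+n^2/(n+1)}$, then $\mathbb{E}[f(x_n)-f^\ast]\le\varepsilon$ for every $n\ge\rho_K\sqrt{\frac{2L}{\varepsilon}}\|x_0-x^\ast\|$. (ii) If $f$ is $\mu$-strongly convex and $s=\frac{1}{L\rho_K}$, $\eta_n=\eta=\frac{1}{\rho_K\sqrt{\mu L}}$, $\beta=1-\frac{1}{\rho_K}\sqrt{\frac\mu L}$, $\alpha_n=\alpha=\frac{1}{1+\frac{1}{\rho_K}\sqrt{\mu/L}}$, then $\mathbb{E}[f(x_n)-f^\ast]\le\varepsilon$ for every $n\ge\rho_K\sqrt{\frac L\mu}\log\!\left(\frac{2(f(x_0)-f^\ast)}{\varepsilon}\right)$.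
   Context: Finite-sum setting: $N\ge2$, $f_i:\mathbb{R}^d\to\mathbb{R}$ continuously differentiable, $f=\frac1N\sum_i f_i$, $f^\ast=\min f$ (attained). $f$ is $L$-smooth if $\nabla f$ is $L$-Lipschitz. For $K\in\{1,\dots,N\}$, $B$ is a uniformly random subset of $\{1,\dots,N\}$ of size $K$ and $\tilde\nabla_K(x)=\frac1K\sum_{i\in B}\nabla f_i(x)$. Strong growth condition (SGC) with constant $\rho_K\ge1$: $\mathbb{E}\|\tilde\nabla_K(x)\|^2\le\rho_K\|\nabla f(x)\|^2$ for all $x$. SNAG: given $x_0=z_0\in\mathbb{R}^d$, $s>0$, $\beta\in[0,1]$, $\alpha_n\in[0,1]$, $\eta_n\ge0$, iterate $y_n=\alpha_nx_n+(1-\alpha_n)z_n$, $x_{n+1}=y_n-s\tilde\nabla_K(y_n)$, $z_{n+1}=\beta z_n+(1-\beta)y_n-\eta_n\tilde\nabla_K(y_n)$, where the same batch is used in both updates of iteration $n$ and batches are independent across iterations. *)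

(* Defs.v *)
From HB Require Import structures.
From mathcomp Require Import all_boot all_order all_algebra.
From mathcomp Require Import all_classical all_reals all_analysis.
Set Implicit Arguments. Unset Strict Implicit. Unset Printing Implicit Defensive.
Import Order.TTheory GRing.Theory Num.Theory.
Import numFieldNormedType.Exports.
Local Open Scope ring_scope.

Definition dotv {R : realType} {d : nat} (u v : 'rV[R]_d) : R :=
  \sum_(j < d) u 0 j * v 0 j.
Definition enorm {R : realType} {d : nat} (u : 'rV[R]_d) : R :=
  Num.sqrt (dotv u u).

Definition fsum {R : realType} {d N : nat} (F : 'I_N -> 'rV[R]_d -> R)
  (x : 'rV[R]_d) : R := N%:R^-1 * \sum_(i < N) F i x.
Definition gsum {R : realType} {d N : nat} (G : 'I_N -> 'rV[R]_d -> 'rV[R]_d)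
  (x : 'rV[R]_d) : 'rV[R]_d := N%:R^-1 *: \sum_(i < N) G i x.

Definition is_C1_grad {R : realType} {d N : nat} (F : 'I_N -> 'rV[R]_d -> R)
  (G : 'I_N -> 'rV[R]_d -> 'rV[R]_d) : Prop :=
  forall i, continuous (G i) /\
    forall x v : 'rV[R]_d, is_derive x v (F i) (dotv (G i x) v).

Definition sgrad {R : realType} {d N : nat} (K : nat)
  (G : 'I_N -> 'rV[R]_d -> 'rV[R]_d) (B : {set 'I_N}) (x : 'rV[R]_d)
  : 'rV[R]_d := K%:R^-1 *: \sum_(i in B) G i x.

Definition batches (N K : nat) : {set {set 'I_N}} :=
  [set B : {set 'I_N} | #|B| == K].

Definition Ebatch {R : realType} (N K : nat) (h : {set 'I_N} -> R) : R :=
  (\sum_(B in batches N K) h B) / #|batches N K|%:R.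

Definition SGC {R : realType} {d N : nat} (K : nat)
  (G : 'I_N -> 'rV[R]_d -> 'rV[R]_d) (rho : R) : Prop :=
  forall x, @Ebatch R N K (fun B => enorm (sgrad K G B x) ^+ 2)
            <= rho * enorm (gsum G x) ^+ 2.

Definition L_smooth {R : realType} {d : nat} (g : 'rV[R]_d -> 'rV[R]_d) (L : R)
  : Prop := forall x y, enorm (g x - g y) <= L * enorm (x - y).

Definition convex_fun {R : realType} {d : nat} (f : 'rV[R]_d -> R) : Prop :=
  forall (x y : 'rV[R]_d) (t : R), 0 <= t <= 1 ->
    f (t *: x + (1 - t) *: y) <= t * f x + (1 - t) * f y.

Definition strongly_convex {R : realType} {d : nat} (mu : R)
  (f : 'rV[R]_d -> R) : Prop :=
  forall (x y : 'rV[R]_d) (t : R), 0 <= t <= 1 ->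
    f (t *: x + (1 - t) *: y)
      <= t * f x + (1 - t) * f y - mu / 2 * t * (1 - t) * enorm (x - y) ^+ 2.

Fixpoint snag {R : realType} {d N : nat} (K : nat)
  (G : 'I_N -> 'rV[R]_d -> 'rV[R]_d) (s beta : R) (alpha eta : nat -> R)
  (b : nat -> {set 'I_N}) (x0 : 'rV[R]_d) (n : nat) : 'rV[R]_d * 'rV[R]_d :=
  match n with
  | 0 => (x0, x0)
  | m.+1 =>
      let xz := snag K G s beta alpha eta b x0 m in
      let y := alpha m *: xz.1 + (1 - alpha m) *: xz.2 in
      let gy := sgrad K G (b m) y in
      (y - s *: gy, beta *: xz.2 + (1 - beta) *: y - eta m *: gy)
  end.

Definition ext_batches {N n : nat} (bs : {ffun 'I_n -> {set 'I_N}})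
  (k : nat) : {set 'I_N} :=
  if insub k is Some i then bs i else [set: 'I_N]%SET.

(** All sequences of n batches of size K (independent, uniform). *)
Definition batch_seqs (N K n : nat) : {set {ffun 'I_n -> {set 'I_N}}} :=
  [set bs : {ffun 'I_n -> {set 'I_N}} | [forall i, bs i \in batches N K]].

(** E[h(x_n)] for the SNAG iterate x_n: average over all equally likely
    batch sequences (B_0, ..., B_{n-1}). *)
Definition E_snag {R : realType} {d N : nat} (K : nat)
  (G : 'I_N -> 'rV[R]_d -> 'rV[R]_d) (s beta : R) (alpha eta : nat -> R)
  (x0 : 'rV[R]_d) (n : nat) (h : 'rV[R]_d -> R) : R :=
  (\sum_(bs in batch_seqs N K n)
      h (snag K G s beta alpha eta (ext_batches bs) x0 n).1)
  / #|batch_seqs N K n|%:R.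

(* Main.v *)
(** Both parts are one-step Lyapunov estimates, averaged over a batch.  The
    batch gradient is unbiased, so the descent lemma at [s = 1/(L rho)] together
    with the strong growth condition gives
    [E f(x_{n+1}) <= f y - |grad f y|^2 / (2 L rho)], while
    [E |w - eta g_B|^2 <= |w|^2 - 2 eta <grad f y, w> + eta^2 rho |grad f y|^2].
    The step sizes make the two [|grad f y|^2] terms cancel in
    - [n^2/(4 L rho^2) (f x_n - f* ) + |z_n - x*|^2 / 2] (convex case), which is
      then nonincreasing in expectation;
    - [(f x_n - f* ) + mu/2 |z_n - x*|^2] (strongly convex case), which then
      contracts by the factor [1 - q] with [q = sqrt (mu/L) / rho].
    The remaining terms are absorbed by the gradient inequality at [x_n] and
    [x*], because [y_n] is a convex combination of [x_n] and [z_n]. *)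

Require Import Defs.
From HB Require Import structures.
From mathcomp Require Import all_boot all_order all_algebra.
From mathcomp Require Import all_classical all_reals all_analysis.
From mathcomp Require Import perm ring lra.
Import Order.TTheory GRing.Theory Num.Theory.
Import numFieldNormedType.Exports.
Local Open Scope ring_scope.

(** * Euclidean inner product and Cauchy-Schwarz *)

Section InnerProduct.
Context {R : realType} {d : nat}.
Implicit Types u v w : 'rV[R]_d.

Lemma dotvC u v : dotv u v = dotv v u.
Proof. by apply: eq_bigr => j _; rewrite mulrC. Qed.

Lemma dotvDl u v w : dotv (u + v) w = dotv u w + dotv v w.
Proof. by rewrite -big_split; apply: eq_bigr => j _; rewrite mxE mulrDl. Qed.

Lemma dotvZl (a : R) u v : dotv (a *: u) v = a * dotv u v.
Proof. by rewrite mulr_sumr; apply: eq_bigr => j _; rewrite mxE mulrA. Qed.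

Lemma dotvNl u v : dotv (- u) v = - dotv u v.
Proof. by rewrite -scaleN1r dotvZl mulN1r. Qed.

Lemma dotvDr u v w : dotv u (v + w) = dotv u v + dotv u w.
Proof. by rewrite dotvC dotvDl !(dotvC u). Qed.

Lemma dotvZr (a : R) u v : dotv u (a *: v) = a * dotv u v.
Proof. by rewrite dotvC dotvZl dotvC. Qed.

Lemma dotvNr u v : dotv u (- v) = - dotv u v.
Proof. by rewrite dotvC dotvNl dotvC. Qed.

Definition dotvE := (dotvDl, dotvDr, dotvZl, dotvZr, dotvNl, dotvNr).

Lemma dotv_suml (I : finType) (P : pred I) (E : I -> 'rV[R]_d) v :
  dotv (\sum_(i | P i) E i) v = \sum_(i | P i) dotv (E i) v.
Proof.
rewrite /dotv exchange_big; apply: eq_bigr => j _.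
by rewrite summxE mulr_suml.
Qed.

Lemma dotv_ge0 u : 0 <= dotv u u.
Proof. by apply: sumr_ge0 => j _; rewrite -expr2 sqr_ge0. Qed.

Lemma enorm_ge0 u : 0 <= enorm u. Proof. exact: sqrtr_ge0. Qed.

Lemma enorm_sqr u : enorm u ^+ 2 = dotv u u.
Proof. by rewrite sqr_sqrtr ?dotv_ge0. Qed.

Lemma dotv_eq0 u : dotv u u = 0 -> u = 0.
Proof.
move=> /eqP; rewrite psumr_eq0 => [|j _]; last by rewrite -expr2 sqr_ge0.
move=> /allP h; apply/rowP => j; rewrite mxE.
have /eqP/eqP := h j (mem_index_enum j).
by rewrite mulf_eq0 orbb => /eqP.
Qed.

(** Cauchy-Schwarz: [dotv v v *: u - dotv u v *: v] has nonnegative squared norm, which equals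
    [dotv v v] times the Gram determinant of [u] and [v]. *)
Lemma dotv_le_enorm u v : dotv u v <= enorm u * enorm v.
Proof.
have [->|v0] := eqVneq v 0.
  by rewrite -(scale0r 0) dotvZr mul0r mulr_ge0 ?enorm_ge0.
have vv_gt0 : 0 < dotv v v.
  rewrite lt_def dotv_ge0 andbT; apply: contra_neq v0; exact: dotv_eq0.
have cs : dotv u v ^+ 2 <= dotv u u * dotv v v.
  have := dotv_ge0 (dotv v v *: u - dotv u v *: v).
  rewrite !dotvE (dotvC v u) => h.
  have : 0 <= dotv v v * (dotv u u * dotv v v - dotv u v ^+ 2).
    by apply: le_trans h _; rewrite le_eqVlt; apply/orP; left; apply/eqP; ring.
  by rewrite pmulr_rge0 // subr_ge0.
rewrite (le_trans (ler_norm _)) // -(@ler_pXn2r _ 2) ?nnegrE ?mulr_ge0 ?enorm_ge0 //.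
by rewrite exprMn !enorm_sqr real_normK ?num_real.
Qed.

End InnerProduct.

(** * Uniform batches and unbiasedness of batch means *)

Section Batches.
Context {R : realType} (N K : nat).
Hypothesis leKN : (K <= N)%N.
Local Notation E := (@Ebatch R N K).

Lemma card_batches : #|batches N K| = 'C(N, K).
Proof. by rewrite -[N in RHS]card_ord -card_draws /batches cardsE. Qed.

Lemma card_batches_gt0 : 0 < #|batches N K|%:R :> R.
Proof. by rewrite ltr0n card_batches bin_gt0. Qed.

Lemma EbatchD (g h : {set 'I_N} -> R) : E (fun B => g B + h B) = E g + E h.
Proof. by rewrite /Ebatch big_split mulrDl. Qed.

Lemma EbatchZ (a : R) (h : {set 'I_N} -> R) : E (fun B => a * h B) = a * E h.
Proof. by rewrite /Ebatch -mulr_sumr mulrA. Qed.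

Lemma Ebatch_cst (a : R) : E (fun=> a) = a.
Proof.
by rewrite /Ebatch sumr_const -(mulr_natr a) mulfK // gt_eqF // card_batches_gt0.
Qed.

Lemma le_Ebatch (g h : {set 'I_N} -> R) : (forall B, g B <= h B) -> E g <= E h.
Proof.
move=> gh; rewrite ler_pM2r ?invr_gt0 ?card_batches_gt0 //.
by apply: ler_sum => B _; apply: gh.
Qed.

(* By symmetry under transpositions every index lies in equally many batches. *)
Lemma card_batches_mem (i j : 'I_N) :
  #|[set B in batches N K | i \in B]| = #|[set B in batches N K | j \in B]|.
Proof.
pose f (B : {set 'I_N}) := [set tperm i j x | x in B].
have fK : involutive f.
  move=> B; rewrite /f -imset_comp -[RHS]imset_id.
  by apply: eq_imset => x /=; rewrite tpermK.
rewrite -(card_imset _ (inv_inj fK)); apply: eq_card => B.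
rewrite -[B]fK mem_imset ?inE; last exact: inv_inj.
rewrite [#|f (f B)|]card_imset; last exact: perm_inj.
congr andb; set C := f B.
by rewrite -[in RHS](tpermL i j) mem_imset //; exact: perm_inj.
Qed.

(** Double counting: after swapping the sums, every index is weighted by the same number [m] of
    batches containing it. *)
Lemma Ebatch_mean (c : 'I_N -> R) : (0 < K)%N ->
  E (fun B => K%:R^-1 * \sum_(i in B) c i) = N%:R^-1 * \sum_(i < N) c i.
Proof.
move=> K0; have N0 : (0 < N)%N by apply: leq_trans leKN.
pose m := #|[set B in batches N K | Ordinal N0 \in B]|.
have cnt (a : 'I_N -> R) :
    \sum_(B in batches N K) \sum_(i in B) a i = m%:R * \sum_i a i.
  rewrite (exchange_big_dep xpredT) //= mulr_sumr; apply: eq_bigr => i _.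
  rewrite sumr_const mulr_natl; congr (_ *+ _).
  by rewrite /m -(card_batches_mem i); apply: eq_card => B; rewrite unfold_in !inE.
(* Constant weights determine [m], since each batch then contributes [K]. *)
have := cnt (fun=> 1); rewrite sumr_const card_ord => mE.
have {}mE : #|batches N K|%:R * K%:R = m%:R * N%:R :> R.
  rewrite -mE (eq_bigr (fun=> K%:R)) ?sumr_const ?mulr_natl //.
  by move=> B; rewrite inE sumr_const => /eqP ->.
rewrite /Ebatch -mulr_sumr cnt.
have := card_batches_gt0; set C := _%:R => C0.
have Kn0 : K%:R != 0 :> R by rewrite pnatr_eq0 -lt0n.
have Nn0 : N%:R != 0 :> R by rewrite pnatr_eq0 -lt0n.
have -> : m%:R = C * K%:R / N%:R by rewrite mE mulfK.
by field; rewrite Nn0 Kn0 gt_eqF.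
Qed.

End Batches.

(** * Smoothness and strong convexity as quadratic bounds *)

Section Smoothness.
Context {R : realType} {d : nat}.
Implicit Types (f : 'rV[R]_d -> R) (g : 'rV[R]_d -> 'rV[R]_d).

(** Both derivatives have the same difference quotient; this brings directional derivatives within
    reach of the one-variable mean value theorem. *)
Lemma is_derive_line {V : normedModType R} (f : V -> R) (y v : V) (t df : R) :
  is_derive (t *: v + y) v f df ->
  is_derive t 1 (fun t : R => f (t *: v + y)) df.
Proof.
have E : (fun h : R => h^-1 *: (((fun t : R => f (t *: v + y)) \o shift t) (h *: 1)
            - f (t *: v + y)))
  = (fun h => h^-1 *: ((f \o shift (t *: v + y)) (h *: v) - f (t *: v + y))).
  by apply/funext => h /=; rewrite [h%:A]mulr1 scalerDl addrA.
case=> df1 df2; split; first by rewrite /derivable E.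
by rewrite /derive E.
Qed.

Lemma L_smooth_descent f g (L : R) :
  (forall x v, is_derive x v f (dotv (g x) v)) -> L_smooth g L ->
  forall y v, f (v + y) <= f y + dotv (g y) v + L / 2 * dotv v v.
Proof.
move=> fg gL y v.
(* [phi] subtracts from [f] along the segment the linear and quadratic terms of the bound, so the
   claim is [phi 1 <= phi 0]. *)
pose phi : R -> R := (fun t : R => f (t *: v + y))
  - (dotv (g y) v \*: id + (L / 2 * dotv v v) \*: (id ^+ 2)).
pose dphi (t : R) := dotv (g (t *: v + y)) v
  - (dotv (g y) v *: 1 + (L / 2 * dotv v v) *: ((2%:R * t ^+ 1) *: 1)).
have dP (t : R) : is_derive t 1 phi (dphi t).
  have d1 := is_derive_line f y v t _ (fg _ _).
  exact: is_deriveB.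
have cP : ({within `[0, 1], continuous phi})%classic.
  by apply: derivable_within_continuous => t _; case: (dP t).
have [t t01] := MVT ltr01 (fun t _ => dP t) cP.
rewrite subr0 mulr1 => phiE.
(* By Cauchy-Schwarz and the Lipschitz bound over the displacement [t *: v], the slope grows by at
   most [L * t * dotv v v], the derivative of the quadratic term. *)
have dle : dphi t <= 0.
  rewrite in_itv /= in t01; case/andP: t01 => t0 t1.
  have h1 := dotv_le_enorm (g (t *: v + y) - g y) v.
  have h2 := gL (t *: v + y) y.
  have h3 : enorm (t *: v + y - y) = t * enorm v.
    rewrite addrK /enorm !dotvE mulrA sqrtrM -?expr2 ?sqr_ge0 //.
    by rewrite sqrtr_sqr ger0_norm // ltW.
  rewrite h3 in h2.
  have h4 : dotv (g (t *: v + y) - g y) v <= L * t * dotv v v.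
    apply: le_trans h1 _; rewrite -enorm_sqr expr2 mulrA ler_wpM2r ?enorm_ge0 //.
    by rewrite -mulrA.
  rewrite !dotvE in h4; rewrite /dphi /GRing.scale /= -mulr_natr; lra.
have phi1 : phi 1 = f (v + y) - (dotv (g y) v + L / 2 * dotv v v).
  by rewrite /phi !fctE /= scale1r expr1n ![_ *: 1]mulr1.
have phi0 : phi 0 = f y.
  by rewrite /phi !fctE /= scale0r add0r expr0n ![_ *: 0]mulr0 addr0 subr0.
move: dle; rewrite -phiE phi1 phi0; lra.
Qed.

(* Compare the lower descent bound with strong convexity on [y + t (x - y)] and let
   [t] tend to 0. *)
Lemma strongly_convex_gradient f g (L mu : R) :
  (forall x v, is_derive x v f (dotv (g x) v)) -> L_smooth g L ->
  strongly_convex mu f ->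
  forall y x, f y + dotv (g y) (x - y) + mu / 2 * dotv (x - y) (x - y) <= f x.
Proof.
move=> fg gL scf y x; set v := x - y.
(* The lower bound is the descent lemma for [- f], whose gradient is Lipschitz with the same
   constant. *)
have lower t : f y + t * dotv (g y) v - L / 2 * t ^+ 2 * dotv v v <= f (t *: v + y).
  have dN z w : is_derive z w (- f) (dotv (- g z) w).
    by rewrite dotvNl; apply: is_deriveN.
  have sN : L_smooth (fun z => - g z) L.
    move=> z w; rewrite -opprD /enorm dotvNl dotvNr opprK; exact: gL.
  have := L_smooth_descent _ _ _ dN sN y (t *: v).
  rewrite fctE !dotvE; lra.
rewrite leNgt; apply/negP => gap.
set D := f y + dotv (g y) v + mu / 2 * dotv v v - f x.
have D0 : 0 < D by rewrite subr_gt0.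
set C := `|L| + `|mu| + 1; set Q := dotv v v; have Q0 : 0 <= Q := dotv_ge0 _.
have key t : 0 < t <= 1 -> D <= t * (C / 2 * Q).
  move=> /andP[t0 t1].
  have := scf x y t; rewrite (ltW t0) t1 => /(_ isT).
  have -> : t *: x + (1 - t) *: y = t *: v + y.
    by rewrite scalerBl scale1r scalerBr addrCA addrC -addrA (addrC _ y).
  rewrite enorm_sqr -/v -/Q => up; have := le_trans (lower t) up.
  rewrite -/Q => h.
  have h' : t * D <= t * (t * ((L + mu) / 2 * Q)) by rewrite /D -/Q; lra.
  have h2 : D <= t * ((L + mu) / 2 * Q) by rewrite -(ler_pM2l t0).
  apply: le_trans h2 _; rewrite ler_pM2l // ler_wpM2r //.
  have := ler_norm L; have := ler_norm mu; rewrite /C; lra.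
have C0 : 0 < C by rewrite /C; have := normr_ge0 L; have := normr_ge0 mu; lra.
(* The witness [t = D / M] lies in (0, 1], and there [key] would give [M <= C / 2 * Q],
   contradicting the choice of [M]. *)
pose M := D + C * Q.
have M0 : 0 < M by rewrite ltr_wpDr // mulr_ge0 // ltW.
have := key (D / M); rewrite divr_gt0 // ler_pdivrMr // mul1r.
have CQ0 : 0 <= C * Q by rewrite mulr_ge0 // ltW.
have -> : D <= M by rewrite /M; lra.
move=> /(_ isT); rewrite mulrAC ler_pdivlMr // ler_pM2l // /M; lra.
Qed.

(** Lets the convex case reuse the gradient inequality with modulus 0. *)
Lemma convex_strongly_convex0 f : convex_fun f -> strongly_convex 0 f.
Proof. by move=> cf x y t t01; rewrite !mul0r subr0; exact: cf. Qed.

End Smoothness.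

(** * Splitting the last batch off a batch sequence *)

Section BatchSequences.
Context {N K : nat}.

(** The new batch goes at [ord_max] because the outermost step of [snag] consumes the latest
    batch. *)
Definition snoc {n} (bs : {ffun 'I_n -> {set 'I_N}}) (B : {set 'I_N}) :
    {ffun 'I_n.+1 -> {set 'I_N}} :=
  [ffun i => if unlift ord_max i is Some j then bs j else B].

Lemma ext_snoc_lt n (bs : {ffun 'I_n -> {set 'I_N}}) B k : (k < n)%N ->
  ext_batches (snoc bs B) k = ext_batches bs k.
Proof.
move=> kn; rewrite /ext_batches (insubT (fun k => k < n.+1)%N (ltnW kn)).
rewrite (insubT (fun k => k < n)%N kn) /= ffunE.
rewrite (_ : Sub k _ = lift ord_max (Ordinal kn)) ?liftK //.
exact/val_inj/esym/lift_max.
Qed.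

Lemma ext_snoc_last n (bs : {ffun 'I_n -> {set 'I_N}}) B :
  ext_batches (snoc bs B) n = B.
Proof.
rewrite /ext_batches (insubT (fun k => k < n.+1)%N (ltnSn n)) /= ffunE.
by rewrite (_ : Sub n _ = ord_max) ?unlift_none //; apply/val_inj.
Qed.

Lemma snoc_batch_seqs n (bs : {ffun 'I_n -> {set 'I_N}}) B :
  (snoc bs B \in batch_seqs N K n.+1) =
  (bs \in batch_seqs N K n) && (B \in batches N K).
Proof.
rewrite !inE; apply/forallP/andP => [h|[/forallP h hB] i].
  split; last by have := h ord_max; rewrite ffunE unlift_none inE.
  by apply/forallP => i; have := h (lift ord_max i); rewrite ffunE liftK.
by rewrite ffunE; case: unliftP => [j _|_]; [exact: h|rewrite inE].
Qed.

(** A finite Fubini identity expressing independence of the last batch: [snoc] is a bijection,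
    inverted by restricting to the first [n] indices and reading off the last value. *)
Lemma big_batch_seqsS (T : Type) (idx : T) (op : Monoid.com_law idx) n
    (h : {ffun 'I_n.+1 -> {set 'I_N}} -> T) :
  \big[op/idx]_(bs in batch_seqs N K n.+1) h bs =
  \big[op/idx]_(bs in batch_seqs N K n)
    \big[op/idx]_(B in batches N K) h (snoc bs B).
Proof.
rewrite (reindex (fun p : {ffun 'I_n -> {set 'I_N}} * {set 'I_N} => snoc p.1 p.2)).
  rewrite pair_big /=; apply: eq_bigl => -[bs B]; exact: snoc_batch_seqs.
exists (fun cs : {ffun 'I_n.+1 -> {set 'I_N}} =>
  ([ffun i => cs (lift ord_max i)], cs ord_max)) => [[bs B]|cs] _.
  congr pair; last by rewrite ffunE unlift_none.
  by apply/ffunP => i; rewrite !ffunE liftK.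
by apply/ffunP => i; rewrite ffunE; case: unliftP => [j|] -> //; rewrite ffunE.
Qed.

Lemma card_batch_seqsS n :
  #|batch_seqs N K n.+1| = (#|batch_seqs N K n| * #|batches N K|)%N.
Proof.
rewrite -sum1_card big_batch_seqsS -sum_nat_const.
by apply: eq_bigr => bs _; rewrite sum1_card.
Qed.

End BatchSequences.

(** * Lyapunov drift over random batch sequences *)

Section Drift.
Context {R : realType} {d N : nat} (K : nat) (G : 'I_N -> 'rV[R]_d -> 'rV[R]_d).
Context (s beta : R) (alpha eta : nat -> R) (x0 : 'rV[R]_d).
Hypothesis leKN : (K <= N)%N.

Definition snag_step n (B : {set 'I_N}) (xz : 'rV[R]_d * 'rV[R]_d) :
    'rV[R]_d * 'rV[R]_d :=
  let y := alpha n *: xz.1 + (1 - alpha n) *: xz.2 in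
  (y - s *: sgrad K G B y,
   beta *: xz.2 + (1 - beta) *: y - eta n *: sgrad K G B y).

(** Observes the whole state, since the Lyapunov functions also depend on the [z] component. *)
Definition E_snag_pair n (h : 'rV[R]_d * 'rV[R]_d -> R) : R :=
  (\sum_(bs in batch_seqs N K n)
      h (snag K G s beta alpha eta (ext_batches bs) x0 n))
  / #|batch_seqs N K n|%:R.

Lemma snag_eq (b c : nat -> {set 'I_N}) n :
  (forall k, (k < n)%N -> b k = c k) ->
  snag K G s beta alpha eta b x0 n = snag K G s beta alpha eta c x0 n.
Proof.
elim: n => //= n IH bc; rewrite IH ?bc // => k kn.
exact/bc/(ltn_trans kn).
Qed.

Lemma snag_snoc n (bs : {ffun 'I_n -> {set 'I_N}}) B :
  snag K G s beta alpha eta (ext_batches (snoc bs B)) x0 n.+1 =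
  snag_step n B (snag K G s beta alpha eta (ext_batches bs) x0 n).
Proof.
rewrite /= ext_snoc_last (snag_eq _ (ext_batches bs)) // => k kn.
exact: ext_snoc_lt.
Qed.

Lemma card_batch_seqs_gt0 n : 0 < #|batch_seqs N K n|%:R :> R.
Proof.
elim: n => [|n IH]; last first.
  by rewrite card_batch_seqsS natrM mulr_gt0 ?card_batches_gt0.
(* For length 0 the batch constraint is vacuous, so any function is a witness. *)
rewrite ltr0n; apply/card_gt0P; exists [ffun=> finset.set0].
by rewrite inE; apply/forallP => -[].
Qed.

(** Tower property: given the first [n] batches the state is fixed, and only the last batch remains
    to be averaged. *)
Lemma E_snag_pairS n h :
  E_snag_pair n.+1 h =
  E_snag_pair n (fun xz => Ebatch K (fun B => h (snag_step n B xz))).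
Proof.
rewrite /E_snag_pair big_batch_seqsS card_batch_seqsS natrM invfM mulrCA mulrC.
congr (_ * _); rewrite mulr_suml; apply: eq_bigr => bs _; rewrite /Ebatch.
by congr (_ * _); apply: eq_bigr => B _; rewrite snag_snoc.
Qed.

Lemma le_E_snag_pair n g h : (forall xz, g xz <= h xz) ->
  E_snag_pair n g <= E_snag_pair n h.
Proof.
move=> gh; rewrite ler_pM2r ?invr_gt0 ?card_batch_seqs_gt0 //.
by apply: ler_sum => bs _; apply: gh.
Qed.

Lemma E_snag_pairZ n (c : R) h : E_snag_pair n (fun xz => c * h xz) = c * E_snag_pair n h.
Proof. by rewrite /E_snag_pair -mulr_sumr mulrA. Qed.

Lemma E_snag_pair_cst n (c : R) : E_snag_pair n (fun=> c) = c.
Proof.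
by rewrite /E_snag_pair sumr_const -(mulr_natr c) mulfK // gt_eqF // card_batch_seqs_gt0.
Qed.

(** The drift bound holds at every state, so it survives averaging over the past; each step then
    contributes one factor [c]. *)
Lemma E_snag_drift (c : R) (V : nat -> 'rV[R]_d * 'rV[R]_d -> R) : 0 <= c ->
  (forall n xz, Ebatch K (fun B => V n.+1 (snag_step n B xz)) <= c * V n xz) ->
  forall n, E_snag_pair n (V n) <= c ^+ n * V 0 (x0, x0).
Proof.
move=> c0 drift; elim=> [|n IH].
  by rewrite -[leRHS](E_snag_pair_cst 0) expr0 mul1r.
rewrite E_snag_pairS (le_trans (le_E_snag_pair _ _ _ (drift n))) //.
by rewrite E_snag_pairZ exprS -mulrA ler_wpM2l.
Qed.

End Drift.

(** * Gradient of the finite sum and one-step expectation bounds *)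

Lemma is_derive_fsum {R : realType} {d N : nat} (F : 'I_N -> 'rV[R]_d -> R)
    (G : 'I_N -> 'rV[R]_d -> 'rV[R]_d) : is_C1_grad F G ->
  forall x v, is_derive x v (fsum F) (dotv (gsum G x) v).
Proof.
move=> FG x v; rewrite /gsum dotvZl dotv_suml.
have -> : fsum F = N%:R^-1 \*: \sum_(i < N) F i.
  by apply/funext => z; rewrite /fsum /= fct_sumE.
apply: is_deriveZ; apply: is_derive_sum => i.
by case: (FG i) => _; apply.
Qed.

Section OneStep.
Context {R : realType} {d N K : nat} (F : 'I_N -> 'rV[R]_d -> R).
Context (G : 'I_N -> 'rV[R]_d -> 'rV[R]_d) (L rho : R).
Hypotheses (K_gt0 : (0 < K)%N) (leKN : (K <= N)%N) (FG : is_C1_grad F G).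
Hypotheses (L_gt0 : 0 < L) (GL : L_smooth (gsum G) L).
Hypotheses (rho_ge1 : 1 <= rho) (sgcG : SGC K G rho).
Local Notation f := (fsum F).
Local Notation g := (gsum G).
Local Notation E := (Ebatch K).

Let rho_gt0 : 0 < rho. Proof. exact: lt_le_trans rho_ge1. Qed.

Lemma Ebatch_dotv_sgrad y w : E (fun B => dotv (sgrad K G B y) w) = dotv (g y) w.
Proof.
rewrite /gsum dotvZl dotv_suml -(Ebatch_mean _ _ leKN) //.
by congr Ebatch; apply/funext => B; rewrite /sgrad dotvZl dotv_suml.
Qed.

Lemma Ebatch_sqr_sgrad y :
  E (fun B => dotv (sgrad K G B y) (sgrad K G B y)) <= rho * dotv (g y) (g y).
Proof.
have := sgcG y; rewrite enorm_sqr; congr (_ <= _); congr Ebatch.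
by apply/funext => B; rewrite enorm_sqr.
Qed.

(** At this step length, strong growth bounds the quadratic term of the descent lemma by half of the
    linear gain, so half of the gain survives. *)
Lemma Ebatch_descent y :
  E (fun B => f (y - (1 / (L * rho)) *: sgrad K G B y)) <=
  f y - (2 * L * rho)^-1 * dotv (g y) (g y).
Proof.
set s := 1 / (L * rho).
have step B : f (y - s *: sgrad K G B y) <= f y
    + (- s * dotv (sgrad K G B y) (g y)
       + L / 2 * s ^+ 2 * dotv (sgrad K G B y) (sgrad K G B y)).
  have := L_smooth_descent _ _ _ (is_derive_fsum _ _ FG) GL y (- (s *: sgrad K G B y)).
  rewrite addrC; move: (sgrad K G B y) (g y) => u v.
  rewrite !dotvE (dotvC v) => h; apply: le_trans h _; lra.
apply: le_trans (le_Ebatch _ _ leKN _ _ step) _.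
rewrite EbatchD (Ebatch_cst _ _ leKN) EbatchD !EbatchZ Ebatch_dotv_sgrad.
have c0 : 0 <= L / 2 * s ^+ 2 by rewrite mulr_ge0 ?sqr_ge0 // divr_ge0 // ltW.
have := ler_wpM2l c0 (Ebatch_sqr_sgrad y).
set X := L / 2 * s ^+ 2 * Ebatch _ _; set Q := dotv (g y) (g y).
have -> : L / 2 * s ^+ 2 * (rho * Q) = (2 * L * rho)^-1 * Q.
  by rewrite /s; field; rewrite !gt_eqF.
have -> : - s * Q = - (2 * ((2 * L * rho)^-1 * Q)).
  by rewrite /s; field; rewrite !gt_eqF.
lra.
Qed.

(** The vector [w] is left free so that each case can insert its own offset from the minimizer
    before the gradient step. *)
Lemma Ebatch_distance (eta : R) y w : 
  E (fun B => dotv (w - eta *: sgrad K G B y) (w - eta *: sgrad K G B y)) <=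
  dotv w w - 2 * eta * dotv (g y) w + eta ^+ 2 * rho * dotv (g y) (g y).
Proof.
have -> : (fun B => dotv (w - eta *: sgrad K G B y) (w - eta *: sgrad K G B y))
  = (fun B => dotv w w + (- (2 * eta) * dotv (sgrad K G B y) w
      + eta ^+ 2 * dotv (sgrad K G B y) (sgrad K G B y))).
  apply/funext => B; move: (sgrad K G B y) => u.
  by rewrite !dotvE (dotvC w); ring.
rewrite EbatchD (Ebatch_cst _ _ leKN) EbatchD !EbatchZ Ebatch_dotv_sgrad.
have := ler_wpM2l (sqr_ge0 eta) (Ebatch_sqr_sgrad y); lra.
Qed.

(** * Convex case: a Lyapunov function nonincreasing in expectation *)

Section Convex.
Variable xstar : 'rV[R]_d.
Hypothesis xstar_min : forall x, f xstar <= f x.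

Definition convex_alpha (k : nat) : R :=
  (k%:R ^+ 2 / k.+1%:R) / (2 + k%:R ^+ 2 / k.+1%:R).

Definition convex_eta (k : nat) : R := 1 / (L * rho ^+ 2) * (k.+1%:R / 2).

Definition convex_lyapunov (n : nat) (xz : 'rV[R]_d * 'rV[R]_d) : R :=
  n%:R ^+ 2 / (4 * L * rho ^+ 2) * (f xz.1 - f xstar)
  + 2^-1 * dotv (xz.2 - xstar) (xz.2 - xstar).

Lemma convex_drift n xz : convex_fun f ->
  E (fun B => convex_lyapunov n.+1
       (snag_step K G (1 / (L * rho)) 1 convex_alpha convex_eta n B xz))
  <= convex_lyapunov n xz.
Proof.
case: xz => x z cf; rewrite /convex_lyapunov /snag_step /=.
set y := convex_alpha n *: x + (1 - convex_alpha n) *: z.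
set eta := convex_eta n; set A1 := n.+1%:R ^+ 2 / _; set A0 := n%:R ^+ 2 / (4 * _ * _).
(* Half of the ratio occurring in [convex_alpha], so that the coupling weight is [t / (1 + t)]. *)
set t := n%:R ^+ 2 / (2 * n.+1%:R) : R.
have n1 : 0 < n.+1%:R :> R by rewrite ltr0n.
have nS : n.+1%:R = n%:R + 1 :> R by rewrite -natr1.
have t0 : 0 <= t by rewrite divr_ge0 ?sqr_ge0 ?mulr_ge0 ?ler0n.
have yz : z - y = t *: (y - x).
  have alphaE : convex_alpha n = t / (1 + t).
    have tE : n%:R ^+ 2 / n.+1%:R = 2 * t by rewrite /t; field; rewrite gt_eqF.
    have -> : convex_alpha n = 2 * t / (2 * (1 + t)).
      by rewrite mulrDr mulr1 -tE.
    by rewrite -mulf_div divff ?mul1r.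
  rewrite /y alphaE; apply/rowP => j; rewrite !mxE; field.
  by rewrite gt_eqF // ltr_wpDr.
have -> : (fun B => A1 * (f (y - (1 / (L * rho)) *: sgrad K G B y) - f xstar) + 2^-1 *
     dotv (1 *: z + (1 - 1) *: y - eta *: sgrad K G B y - xstar)
          (1 *: z + (1 - 1) *: y - eta *: sgrad K G B y - xstar))
   = (fun B => A1 * (f (y - (1 / (L * rho)) *: sgrad K G B y) + - f xstar) + 2^-1 *
     dotv (z - xstar - eta *: sgrad K G B y) (z - xstar - eta *: sgrad K G B y)).
  by apply/funext => B; rewrite subrr scale0r addr0 scale1r [z - _ - _]addrAC.
rewrite EbatchD !EbatchZ EbatchD (Ebatch_cst _ _ leKN).
have grad := strongly_convex_gradient _ _ _ _ (is_derive_fsum _ _ FG) GL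
   (convex_strongly_convex0 _ cf) y.
have gs := grad xstar; have gx := grad x; rewrite !mul0r !addr0 in gs gx.
have E1 := Ebatch_descent y; have E2 := Ebatch_distance eta y (z - xstar).
set X1 := Ebatch _ _ in E1 *; set X2 := Ebatch _ _ in E2 *.
have min_y := xstar_min y.
have eta0 : 0 <= eta.
  rewrite mulr_ge0 ?divr_ge0 ?ler0n // mulr_ge0 ?sqr_ge0 //; exact: ltW.
have den0 : 0 <= 4 * L * rho ^+ 2.
  by apply/ltW/mulr_gt0; [apply: mulr_gt0|apply: exprn_gt0].
have A10 : 0 <= A1 by rewrite divr_ge0 ?sqr_ge0.
(* Splits [z - xstar] into the two directions along which the gradient inequality is applied,
   towards [xstar] and towards [x]. *)
have zs : dotv (g y) (z - xstar) = dotv (g y) (y - xstar) + t * dotv (g y) (y - x).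
  by rewrite -dotvZr -yz -dotvDr [in RHS]addrC subrKA.
rewrite zs in E2.
(* Hence the gradient inequality at [x] enters with exactly the current weight of the gap. *)
have etat : eta * t = A0.
  by rewrite /eta /convex_eta /t /A0; field; rewrite !gt_eqF.
(* This rests on [n^2 + 2(n+1) = (n+1)^2 + 1]; the slack has the right sign because [f y] is at
   least the minimum. *)
have A1le : A1 <= eta + A0.
  have -> : eta + A0 = A1 + 1 / (4 * L * rho ^+ 2).
    rewrite /eta /convex_eta /A0 /A1 nS; field; rewrite !gt_eqF //.
  by rewrite lerDl divr_ge0.
(* The quadratic error in the distance bound equals the descent gain weighted by [A1]. *)
have quad : eta ^+ 2 * rho / 2 = A1 * (2 * L * rho)^-1.
  by rewrite /eta /convex_eta /A1; field; rewrite !gt_eqF.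
have h1 : A1 * X1 <= A1 * f y - eta ^+ 2 * rho / 2 * dotv (g y) (g y).
  by rewrite quad -[X in _ - X]mulrA -mulrBr ler_wpM2l.
have gs' : f y - f xstar <= dotv (g y) (y - xstar).
  by rewrite -(opprB xstar) dotvNr; lra.
have gx' : f y - f x <= dotv (g y) (y - x).
  by rewrite -(opprB x) dotvNr; lra.
have h2 := ler_wpM2l eta0 gs'.
have h3 := ler_wpM2l (mulr_ge0 eta0 t0) gx'; rewrite etat in h3.
have h4 : A1 * (f y - f xstar) <= (eta + A0) * (f y - f xstar).
  by rewrite ler_wpM2r // subr_ge0.
move: E2.
have -> : 2 * eta * (dotv (g y) (y - xstar) + t * dotv (g y) (y - x)) =
  2 * (eta * dotv (g y) (y - xstar)) + 2 * (A0 * dotv (g y) (y - x)).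
  by rewrite -etat; ring.
lra.
Qed.

End Convex.

(** * Strongly convex case: contraction of the Lyapunov function *)

Section StronglyConvex.
Variables (xstar : 'rV[R]_d) (mu : R).
Hypothesis mu_gt0 : 0 < mu.

Definition sc_rate : R := 1 / rho * Num.sqrt (mu / L).

Definition sc_lyapunov (xz : 'rV[R]_d * 'rV[R]_d) : R :=
  (f xz.1 - f xstar) + mu / 2 * dotv (xz.2 - xstar) (xz.2 - xstar).

Lemma sc_rate_gt0 : 0 < sc_rate.
Proof. by rewrite mulr_gt0 ?sqrtr_gt0 ?divr_gt0. Qed.

Lemma sc_rate_sqr : sc_rate ^+ 2 = mu / (L * rho ^+ 2).
Proof.
rewrite exprMn sqr_sqrtr ?divr_ge0 ?ltW //; by field; rewrite !gt_eqF.
Qed.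

Lemma sc_etaE : 1 / (rho * Num.sqrt (mu * L)) = sc_rate / mu.
Proof.
have sL : 0 < Num.sqrt L by rewrite sqrtr_gt0.
have sm : 0 < Num.sqrt mu by rewrite sqrtr_gt0.
rewrite /sc_rate !sqrtrM ?ltW // sqrtrV ?ltW //.
have muE : mu = Num.sqrt mu ^+ 2 by rewrite sqr_sqrtr // ltW.
move: sm muE; set a := Num.sqrt mu => sm ->.
by field; rewrite !gt_eqF.
Qed.

Lemma sc_drift n xz : sc_rate <= 1 -> strongly_convex mu f ->
  E (fun B => sc_lyapunov
       (snag_step K G (1 / (L * rho)) (1 - sc_rate)
          (fun=> 1 / (1 + sc_rate)) (fun=> sc_rate / mu) n B xz))
  <= (1 - sc_rate) * sc_lyapunov xz.
Proof.
case: xz => x z q1 scf; rewrite /sc_lyapunov /snag_step /=.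
set q := sc_rate; have q0 : 0 < q := sc_rate_gt0.
set y := (1 / (1 + q)) *: x + (1 - 1 / (1 + q)) *: z; set eta := q / mu.
(* The coupling weight [1 / (1 + q)] is chosen for this identity, which lets [gw] trade [z - y] for
   [y - x]. *)
have yx : y - x = q *: (z - y).
  by apply/rowP => j; rewrite !mxE; field; rewrite gt_eqF // addr_gt0.
(* The offset of the new [z] from [xstar] before the gradient step, as a convex combination ready
   for [ww]. *)
set w := (1 - q) *: (z - xstar) + q *: (y - xstar).
have -> : (fun B => f (y - (1 / (L * rho)) *: sgrad K G B y) - f xstar + mu / 2 *
     dotv ((1 - q) *: z + (1 - (1 - q)) *: y - eta *: sgrad K G B y - xstar)
          ((1 - q) *: z + (1 - (1 - q)) *: y - eta *: sgrad K G B y - xstar))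
   = (fun B => (f (y - (1 / (L * rho)) *: sgrad K G B y) + - f xstar) + mu / 2 *
     dotv (w - eta *: sgrad K G B y) (w - eta *: sgrad K G B y)).
  apply/funext => B; congr (_ + _ * dotv _ _);
    by apply/rowP => j; rewrite !mxE; ring.
rewrite EbatchD EbatchZ EbatchD (Ebatch_cst _ _ leKN).
have grad := strongly_convex_gradient _ _ _ _ (is_derive_fsum _ _ FG) GL scf y.
have gs := grad xstar; have gx := grad x.
have E1 := Ebatch_descent y; have E2 := Ebatch_distance eta y w.
set X1 := Ebatch _ _ in E1 *; set X2 := Ebatch _ _ in E2 *.
have quad : mu / 2 * (eta ^+ 2 * rho) = (2 * L * rho)^-1.
  have -> : eta ^+ 2 = q ^+ 2 / mu ^+ 2 by rewrite exprMn exprVn.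
  by rewrite sc_rate_sqr; field; rewrite !gt_eqF.
have muq : mu * eta = q by rewrite /eta; field; rewrite gt_eqF.
have gw : q * dotv (g y) w = q * dotv (g y) (y - xstar) + (1 - q) * dotv (g y) (y - x).
  have -> : w = (y - xstar) + (1 - q) *: (z - y).
    by apply/rowP => j; rewrite !mxE; ring.
  by rewrite yx !dotvDr !dotvZr; ring.
(* The squared norm of a convex combination obeys an exact identity, whose nonpositive defect is
   dropped. *)
have ww : dotv w w <= (1 - q) * dotv (z - xstar) (z - xstar)
    + q * dotv (y - xstar) (y - xstar).
  have -> : dotv w w = (1 - q) * dotv (z - xstar) (z - xstar)
    + q * dotv (y - xstar) (y - xstar) - (1 - q) * q * dotv (z - y) (z - y).
    have -> : z - y = (z - xstar) - (y - xstar) by rewrite opprB addrA subrK.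
    rewrite /w; move: (z - xstar) (y - xstar) => a b.
    by rewrite !dotvE (dotvC b a); ring.
  by rewrite gerBl mulr_ge0 ?dotv_ge0 // mulr_ge0 ?subr_ge0 // ltW.
have gs' : f y - f xstar + mu / 2 * dotv (y - xstar) (y - xstar)
    <= dotv (g y) (y - xstar).
  rewrite -(opprB xstar) dotvNl !dotvNr; lra.
have gx' : f y - f x <= dotv (g y) (y - x).
  have : 0 <= mu / 2 * dotv (x - y) (x - y).
    by rewrite mulr_ge0 ?dotv_ge0 // divr_ge0 // ltW.
  rewrite -(opprB x) dotvNr; lra.
(* With weights [q] and [1 - q] the values [f y] cancel, leaving [1 - q] times the gap at [x]; the
   [mu] term of [gs'] absorbs the [y] term of [ww]. *)
have h1 := ler_wpM2l (ltW q0) gs'.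
have q1' : 0 <= 1 - q by rewrite subr_ge0.
have h2 := ler_wpM2l q1' gx'.
have mu2 : 0 <= mu / 2 by rewrite divr_ge0 // ltW.
have h3 := ler_wpM2l mu2 E2; have h4 := ler_wpM2l mu2 ww.
have h5 : mu / 2 * (dotv w w - 2 * eta * dotv (g y) w + eta ^+ 2 * rho * dotv (g y) (g y))
  = mu / 2 * dotv w w - q * dotv (g y) w + (2 * L * rho)^-1 * dotv (g y) (g y).
  by rewrite -quad -[in RHS]muq; field.
rewrite h5 gw in h3; lra.
Qed.

(** The quadratic lower and upper bounds sandwich [f x]; since [x] differs from [y], their
    coefficients can be compared. *)
Lemma sc_smooth_le (x y : 'rV[R]_d) : strongly_convex mu f -> x != y -> mu <= L.
Proof.
move=> scf xy; rewrite -subr_eq0 in xy.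
have h1 := strongly_convex_gradient _ _ _ _ (is_derive_fsum _ _ FG) GL scf y x.
have := L_smooth_descent _ _ _ (is_derive_fsum _ _ FG) GL y (x - y).
rewrite subrK => h2.
have Q0 : 0 < dotv (x - y) (x - y).
  by rewrite lt_def dotv_ge0 andbT; apply: contra_neq xy; apply: dotv_eq0.
by rewrite -(ler_pM2r Q0); lra.
Qed.

(** The gradient inequality based at the minimizer bounds the distance term by one more copy of the
    gap. *)
Lemma sc_lyapunov0 x : (forall x, f xstar <= f x) -> strongly_convex mu f ->
  sc_lyapunov (x, x) <= 2 * (f x - f xstar).
Proof.
move=> smin scf.
have fg := is_derive_fsum _ _ FG.
(* The gradient vanishes at [xstar]: a step of length 1/L cannot decrease f. *)
have g0 : dotv (g xstar) (g xstar) = 0.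
  have h := L_smooth_descent _ _ _ fg GL xstar (- L^-1 *: g xstar).
  have := le_trans (smin _) h; move: (g xstar) => u; rewrite !dotvE.
  have -> : L / 2 * (- L^-1 * (- L^-1 * dotv u u)) = L^-1 / 2 * dotv u u.
    by field; rewrite gt_eqF.
  move=> {}h; have {h}: L^-1 * dotv u u <= 0 by lra.
  rewrite pmulr_rle0 ?invr_gt0 // => h.
  by apply/le_anti; rewrite h dotv_ge0.
have := strongly_convex_gradient _ _ _ _ fg GL scf xstar x.
rewrite (dotv_eq0 _ g0) -(scale0r 0) dotvZl mul0r /sc_lyapunov /=; lra.
Qed.

End StronglyConvex.
End OneStep.

(** * From expected decay to iteration counts *)

Theorem theorem3 (R : realType) (d N K : nat)
  (F : 'I_N -> 'rV[R]_d -> R) (G : 'I_N -> 'rV[R]_d -> 'rV[R]_d)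
  (L rho eps : R) (xstar x0 : 'rV[R]_d) :
  (2 <= N)%N -> (1 <= K <= N)%N ->
  is_C1_grad F G ->
  (forall x, fsum F xstar <= fsum F x) ->
  0 < L -> L_smooth (gsum G) L ->
  1 <= rho -> SGC K G rho ->
  0 < eps ->
  (* (i) convex case *)
  (convex_fun (fsum F) ->
   forall n : nat,
     rho * Num.sqrt (2 * L / eps) * enorm (x0 - xstar) <= n%:R ->
     E_snag K G (1 / (L * rho)) 1
       (fun k => (k%:R ^+ 2 / k.+1%:R) / (2 + k%:R ^+ 2 / k.+1%:R))
       (fun k => 1 / (L * rho ^+ 2) * (k.+1%:R / 2))
       x0 n (fun x => fsum F x - fsum F xstar) <= eps)
  /\
  (* (ii) strongly convex case *)
  (forall mu : R, 0 < mu -> strongly_convex mu (fsum F) ->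
   forall n : nat,
     rho * Num.sqrt (L / mu)
       * ln (2 * (fsum F x0 - fsum F xstar) / eps) <= n%:R ->
     E_snag K G (1 / (L * rho)) (1 - 1 / rho * Num.sqrt (mu / L))
       (fun _ => 1 / (1 + 1 / rho * Num.sqrt (mu / L)))
       (fun _ => 1 / (rho * Num.sqrt (mu * L)))
       x0 n (fun x => fsum F x - fsum F xstar) <= eps).
Proof.
move=> N2 /andP[K0 KN] FG smin L0 GL rho1 sgc eps0.
have rho0 : 0 < rho by apply: lt_le_trans rho1.
have gap0 x : 0 <= fsum F x - fsum F xstar by rewrite subr_ge0.
split=> [cf n nle | mu mu0 scf n nle].
(* At [n = 0] the gap has weight 0 and cannot be isolated, but the hypothesis then forces
   [x0 = xstar]. *)
- have [n0|n0] := posnP n.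
    have /eqP : rho * Num.sqrt (2 * L / eps) * enorm (x0 - xstar) = 0.
      apply/le_anti; rewrite (le_trans nle) ?n0 //= mulr_ge0 ?enorm_ge0 //.
      by rewrite mulr_ge0 ?sqrtr_ge0 // ltW.
    rewrite mulf_eq0 gt_eqF /=; last by rewrite mulr_gt0 // sqrtr_gt0 divr_gt0 ?mulr_gt0.
    rewrite sqrtr_eq0 => x0s.
    have /eqP : x0 - xstar = 0 by apply/dotv_eq0/le_anti; rewrite x0s dotv_ge0.
    rewrite subr_eq0 => /eqP ->.
    rewrite n0 /E_snag big1 ?mul0r ?ltW // => bs _ /=; exact: subrr.
  pose V := convex_lyapunov F L rho xstar.
  have step m xz : Ebatch K (fun B => V m.+1 (snag_step K G (1 / (L * rho)) 1
      convex_alpha (convex_eta L rho) m B xz)) <= 1 * V m xz.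
    rewrite [leRHS]mul1r.
    exact: (convex_drift F G L rho K0 KN FG L0 GL rho1 sgc xstar smin m xz cf).
  have drift := E_snag_drift K G (1 / (L * rho)) 1 convex_alpha (convex_eta L rho)
    x0 KN 1 V ler01 step n.
  have V0 : 1 ^+ n * V 0 (x0, x0) = 2^-1 * dotv (x0 - xstar) (x0 - xstar).
    by rewrite expr1n mul1r /V /convex_lyapunov expr0n /= !mul0r add0r.
  set c := n%:R ^+ 2 / (4 * L * rho ^+ 2).
  have n0R : 0 < n%:R :> R by rewrite ltr0n.
  have c0 : 0 < c by rewrite divr_gt0 ?exprn_gt0 // mulr_gt0 ?exprn_gt0 // mulr_gt0.
  set Ef := E_snag _ _ _ _ _ _ _ _ _.
  have EfV : c * Ef <= 2^-1 * dotv (x0 - xstar) (x0 - xstar).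
    rewrite -V0; apply: le_trans drift.
    have -> : Ef = E_snag_pair K G (1 / (L * rho)) 1 convex_alpha
      (convex_eta L rho) x0 n (fun xz => fsum F xz.1 - fsum F xstar) by [].
    rewrite -E_snag_pairZ.
    apply: (le_E_snag_pair _ _ _ _ _ _ _ KN) => xz.
    by rewrite /V /convex_lyapunov lerDl mulr_ge0 ?dotv_ge0.
  rewrite -(ler_pM2l c0) (le_trans EfV) //.
  (* Squared and multiplied by [eps / (4 * L * rho ^+ 2)], the condition on [n] says that [c * eps]
     dominates the initial Lyapunov value. *)
  have : (rho * Num.sqrt (2 * L / eps) * enorm (x0 - xstar)) ^+ 2 <= n%:R ^+ 2.
    rewrite ler_pXn2r ?nnegrE ?ler0n // mulr_ge0 ?enorm_ge0 //.
    by rewrite mulr_ge0 ?sqrtr_ge0 // ltW.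
  rewrite !exprMn enorm_sqr sqr_sqrtr; last by rewrite divr_ge0 ?mulr_ge0 ?ltW.
  have k0 : 0 < eps / (4 * L * rho ^+ 2).
    by rewrite divr_gt0 // mulr_gt0 ?exprn_gt0 // mulr_gt0.
  rewrite -(ler_pM2r k0) => h.
  have -> : c * eps = n%:R ^+ 2 * (eps / (4 * L * rho ^+ 2)) by rewrite /c; ring.
  apply: le_trans h; rewrite le_eqVlt; apply/orP; left; apply/eqP.
  by field; rewrite !gt_eqF.
- rewrite -/(sc_rate L rho mu) sc_etaE //; set q := sc_rate L rho mu.
  have q0 : 0 < q by apply: sc_rate_gt0.
  have [q1|q1] := leP q 1; last first.
    (* [q > 1] forces [mu > L], which is possible only in a zero-dimensional space. *)
    have eqs x : x = xstar.
      apply/eqP/negPn/negP => xs; move: q1; apply/negP; rewrite -leNgt.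
      have muL : mu <= L := sc_smooth_le F G L FG GL mu x xstar scf xs.
      rewrite -(@ler_pXn2r _ 2) ?nnegrE ?(ltW q0) // expr1n sc_rate_sqr //.
      rewrite ler_pdivrMr ?mul1r ?mulr_gt0 ?exprn_gt0 // (le_trans muL) //.
      by rewrite ler_peMr ?exprn_ege1 // ltW.
    by rewrite /E_snag big1 ?mul0r ?ltW // => bs _; rewrite (eqs (_.1)) subrr.
  have q1' : 0 <= 1 - q by rewrite subr_ge0.
  have drift := E_snag_drift K G (1 / (L * rho)) (1 - q) (fun=> 1 / (1 + q)) (fun=> q / mu)
    x0 KN (1 - q) (fun=> sc_lyapunov F xstar mu) q1'
    (fun n xz => sc_drift F G L rho K0 KN FG L0 GL rho1 sgc xstar mu mu0 n xz q1 scf) n.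
  set Ef := E_snag _ _ _ _ _ _ _ _ _.
  have EfV : Ef <= (1 - q) ^+ n * sc_lyapunov F xstar mu (x0, x0).
    apply: le_trans drift.
    have -> : Ef = E_snag_pair K G (1 / (L * rho)) (1 - q) (fun=> 1 / (1 + q))
      (fun=> q / mu) x0 n (fun xz => fsum F xz.1 - fsum F xstar) by [].
    apply: (le_E_snag_pair _ _ _ _ _ _ _ KN) => xz.
    by rewrite lerDl mulr_ge0 ?dotv_ge0 // divr_ge0 // ltW.
  have {EfV} Ef2 : Ef <= (1 - q) ^+ n * (2 * (fsum F x0 - fsum F xstar)).
    apply: le_trans EfV _; rewrite ler_wpM2l ?exprn_ge0 //.
    exact: (sc_lyapunov0 F G L FG L0 GL).
  apply: le_trans Ef2 _; set D := 2 * _ in nle *.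
  have D0 : 0 <= D by rewrite mulr_ge0.
  (* At [D = 0] the logarithm is only a default value, but the bound already obtained is 0. *)
  have [->|Dn0] := eqVneq D 0; first by rewrite mulr0 ltW.
  have Dgt0 : 0 < D by rewrite lt_def Dn0.
  have rate : rho * Num.sqrt (L / mu) = q^-1.
    rewrite /q /sc_rate div1r invfM invrK -sqrtrV ?invf_div //.
    by rewrite divr_ge0 // ltW.
  have qn : ln (D / eps) <= n%:R * q by rewrite -ler_pdivrMr // mulrC -rate.
  (* This is [1 + x <= expR x] at [x = - q], raised to the power [n]. *)
  have : (1 - q) ^+ n <= expR (- (n%:R * q)).
    rewrite -[- (n%:R * q)]mulrN expRM_natl lerXn2r ?nnegrE ?expR_ge0 //.
    exact: expR_ge1Dx.
  have : expR (- (n%:R * q)) <= (D / eps)^-1.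
    by rewrite -[X in X^-1]lnK ?posrE ?divr_gt0 // -expRN ler_expR lerN2.
  rewrite invf_div => h1 h2; have := le_trans h2 h1.
  by rewrite ler_pdivlMr.
Qed.
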